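(* Let $\mathfrak{F}=(X,\perp,Y,R)$ be a frame in one of the frame classes $\mathbb{NFL},\mathbb{FL},\mathbb{BCI},\mathbb{BCK},\mathbb{BCW}$ and let $\mathfrak{M}=(\mathfrak{F},\imath)$ be a sorted modal model on it. Define a substructural model $\mathfrak{N}$ on $\mathfrak{F}$ by setting $V(p_i)=\Box_1\Diamond_2\,\imath(P_i)$. Then for all substructural sentences $\varphi,\psi$: 1. $[\![\varphi]\!]_\mathfrak{N}=[\![\varphi^\bullet]\!]_\mathfrak{M}=[\![\Box_1\neg\varphi^\circ]\!]_\mathfrak{M}=[\![\Box_1\Diamond_2\varphi^\bullet]\!]_\mathfrak{M}$; 2. $(\!|\varphi|\!)_\mathfrak{N}=(\!|\varphi^\circ|\!)_\mathfrak{M}=(\!|\Box_2\neg\varphi^\bullet|\!)_\mathfrak{M}=(\!|\Box_2\Diamond_1\varphi^\circ|\!)_\mathfrak{M}$; 3. $\varphi\Vdash\psi$ iff $\varphi^\bullet\models\psi^\bullet$ iff $\psi^\circ\models\varphi^\circ$.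
   Context: Frames: $\mathfrak{F}=(X,\perp,Y,R)$ with $X,Y$ nonempty, $\perp\subseteq X\times Y$ (Galois relation), $I$ the complement of $\perp$, assumed to satisfy: every $x\in X$ has some $y$ with $xIy$ and every $y\in Y$ has some $x$ with $xIy$; $R\subseteq X\times X\times X$. Set operators: $\Diamond_2U=\{y\mid\exists x\,(xIy\wedge x\in U)\}$, $\Box_1V=\{x\mid\forall y\,(xIy\to y\in V)\}$, $\Box_2U=Y\setminus\Diamond_2(X\setminus U)$, $\Diamond_1V=X\setminus\Box_1(Y\setminus V)$. Galois maps $U^\perp=\{y\mid\forall x\in U\;x\perp y\}$, ${}^\perp V=\{x\mid\forall y\in V\;x\perp y\}$; $A\subseteq X$ is stable if ${}^\perp(A^\perp)=A$ (equivalently $A=\Box_1\Diamond_2A$). Preorder $x\preceq z$ iff $\{x\}^\perp\subseteq\{z\}^\perp$. Constraints: (C1) for all $w,z,u,v\in X$: $\exists x(xRuv\wedge zRxw)$ iff $\exists x(xRvw\wedge zRux)$; (C2) $xRzz'\leftrightarrow xRz'z$; (C3) $xRzz'\to z'\preceq x$; (C4) $xRxx$. Classes: $\mathbb{NFL}$ all frames, $\mathbb{FL}$ (C1), $\mathbb{BCI}$ (C1,C2), $\mathbb{BCK}$ (C1,C2,C3), $\mathbb{BCW}$ (C1,C2,C4). Substructural language: $\varphi::=p_i\mid\top\mid\bot\mid\varphi\wedge\varphi\mid\varphi\vee\varphi\mid\varphi\leftarrow\varphi\mid\varphi\circ\varphi\mid\varphi\to\varphi$. A substructural model $(\mathfrak{F},V)$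 has $V(p_i)$ stable; each sentence gets extent $[\![\varphi]\!]\subseteq X$ ($x\Vdash\varphi$) and intent $(\!|\varphi|\!)=[\![\varphi]\!]^\perp\subseteq Y$ ($y$ co-satisfies $\varphi$), with $x\Vdash\varphi$ iff $\forall y(y$ co-satisfies $\varphi\to x\perp y)$ and dually. Let $yR^{\partial}zz'$ iff $\forall x(xRzz'\to x\perp y)$. Clauses: $x\Vdash p_i$ iff $x\in V(p_i)$; $x\Vdash\top$ always; every $y$ co-satisfies $\bot$; $x\Vdash\varphi\wedge\psi$ iff both; $y$ co-satisfies $\varphi\vee\psi$ iff it co-satisfies both; $x\Vdash\varphi\to\psi$ iff $\forall z\forall y(z\Vdash\varphi\wedge y$ co-sat. $\psi\to yR^\partial zx)$; $y$ co-satisfies $\varphi\circ\psi$ iff $\forall x,z(z\Vdash\varphi\wedge x\Vdash\psi\to yR^\partial zx)$; $x\Vdash\psi\leftarrow\varphi$ iff $\forall y\forall z(y$ co-sat. $\psi\wedge z\Vdash\varphi\to yR^\partial xz)$. $\varphi\Vdash\psi$ means $[\![\varphi]\!]_\mathfrak{N}\subseteq[\![\psi]\!]_\mathfrak{N}$. Sorted modal language: sort 1: $\alpha::=P_i\mid\neg\alpha\mid\alpha\wedge\alpha\mid\Box_1\beta\mid\alpha\odot\alpha\mid\alpha\leftharpoonup\alpha\mid\alpha\rightharpoonup\alpha$; sort 2: $\beta::=Q_i\mid\neg\beta\mid\beta\wedge\beta\mid\Box_2\alpha$; $\Diamond_1\beta:=\neg\Box_1\neg\beta$, $\Diamond_2\alpha:=\neg\Box_2\neg\alpha$;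 $\top,\bot$ sort-1 constants, ${\tt t},{\tt f}$ sort-2 constants. Model $\mathfrak{M}=(\mathfrak{F},\imath)$, $\imath(P_i)\subseteq X$, $\imath(Q_i)\subseteq Y$, classical clauses in each sort, and: $x\models\alpha\odot\alpha'$ iff $\exists z,z'(xRzz'\wedge z\models\alpha\wedge z'\models\alpha')$; $x\models\alpha\rightharpoonup\alpha'$ iff $\forall z,z'(z\models\alpha\wedge z'Rzx\to z'\models\alpha')$; $x\models\alpha'\leftharpoonup\alpha$ iff $\forall z,z'(z\models\alpha\wedge z'Rxz\to z'\models\alpha')$; $x\models\Box_1\beta$ iff $\forall y(xIy\to y\models\beta)$; $y\models\Box_2\alpha$ iff $\forall x(xIy\to x\models\alpha)$. $[\![\alpha]\!]_\mathfrak{M}$, $(\!|\beta|\!)_\mathfrak{M}$ are the truth sets. Translation/co-translation: $p_i^\bullet=\Box_1\Diamond_2P_i$, $p_i^\circ=\Box_2\neg P_i$; $\top^\bullet=\top$, $\top^\circ={\tt f}$; $\bot^\bullet=\bot$, $\bot^\circ={\tt t}$; $(\varphi\wedge\psi)^\bullet=\varphi^\bullet\wedge\psi^\bullet$, $(\varphi\wedge\psi)^\circ=\Box_2(\Diamond_1\varphi^\circ\vee\Diamond_1\psi^\circ)$; $(\varphi\vee\psi)^\bullet=\Box_1(\Diamond_2\varphi^\bullet\vee\Diamond_2\psi^\bullet)$, $(\varphi\vee\psi)^\circ=\varphi^\circ\wedge\psi^\circ$; $(\varphi\circ\psi)^\bullet=\Box_1\Diamond_2(\varphi^\bullet\odot\psi^\bullet)$,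 $(\varphi\circ\psi)^\circ=\Box_2\neg(\varphi^\bullet\odot\psi^\bullet)$; $(\varphi\to\psi)^\bullet=\varphi^\bullet\rightharpoonup\psi^\bullet$, $(\varphi\to\psi)^\circ=\Box_2\neg(\varphi\to\psi)^\bullet$; $(\psi\leftarrow\varphi)^\bullet=\psi^\bullet\leftharpoonup\varphi^\bullet$, $(\psi\leftarrow\varphi)^\circ=\Box_2\neg(\psi\leftarrow\varphi)^\bullet$.
   Formalization: That the valuation V(p_i)=□₁◇₂ι(P_i) yields a substructural model (extent and intent determine each other for every sentence) is assumed, not proved; on arbitrary frames of these classes it can fail for implications, whose extents need not be stable. *)

(* Defs.v *)
From mathcomp Require Import all_boot boolp classical_sets.

Set Implicit Arguments.
Unset Strict Implicit.
Unset Printing Implicit Defensive.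

Local Open Scope classical_set_scope.

Record frame := Frame {
  fX : Type;
  fY : Type;
  perp : fX -> fY -> Prop;
  fR : fX -> fX -> fX -> Prop;
  fX_inhabited : inhabited fX;
  fY_inhabited : inhabited fY;
  frame_serialX : forall x, exists y, ~ perp x y;
  frame_serialY : forall y, exists x, ~ perp x y }.

Arguments perp {f} x y.
Arguments fR {f} x z z'.

Section FrameOperators.
Variable F : frame.
Implicit Types (x z u v w : fX F) (y : fY F) (A : set (fX F)) (B : set (fY F)).

Definition fI x y : Prop := ~ perp x y.

Definition rperp A : set (fY F) := [set y | forall x, A x -> perp x y].
Definition lperp B : set (fX F) := [set x | forall y, B y -> perp x y].

Definition stable A : Prop := lperp (rperp A) = A.

Definition preceq x z : Prop := rperp [set x] `<=` rperp [set z].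

Definition sdia2 A : set (fY F) := [set y | exists x, fI x y /\ A x].
Definition sbox1 B : set (fX F) := [set x | forall y, fI x y -> B y].

Definition Rdual y z z' : Prop := forall x, fR x z z' -> perp x y.

Definition C1 : Prop := forall w z u v,
  (exists x, fR x u v /\ fR z x w) <-> (exists x, fR x v w /\ fR z u x).
Definition C2 : Prop := forall x z z', fR x z z' <-> fR x z' z.
Definition C3 : Prop := forall x z z', fR x z z' -> preceq z' x.
Definition C4 : Prop := forall x, fR x x x.

End FrameOperators.

Inductive frame_class := NFL | FL | BCI | BCK | BCW.

Definition in_class (c : frame_class) (F : frame) : Prop :=
  match c with
  | NFL => True
  | FL => C1 F
  | BCI => C1 F /\ C2 F
  | BCK => [/\ C1 F, C2 F & C3 F]
  | BCW => [/\ C1 F, C2 F & C4 F]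
  end.

(* [SLimp a b] is a <- b, and [SRimp a b] is a -> b. *)
Inductive sform :=
  | SVar of nat
  | STop
  | SBot
  | SAnd of sform & sform
  | SOr of sform & sform
  | SLimp of sform & sform
  | SFuse of sform & sform
  | SRimp of sform & sform.

Section SubstructuralSemantics.
Variable F : frame.

Definition of_extent (A : set (fX F)) : set (fX F) * set (fY F) :=
  (A, rperp A).
Definition of_intent (B : set (fY F)) : set (fX F) * set (fY F) :=
  (lperp B, B).

(* The pair (extent, intent).  Each connective has a clause for one component
   only; the other component is its image under the Galois map. *)
Fixpoint interp (V : nat -> set (fX F)) (phi : sform) :
    set (fX F) * set (fY F) :=
  match phi with
  | SVar i => of_extent (V i)
  | STop => of_extent setT
  | SBot => of_intent setT
  | SAnd a b => of_extent [set x | (interp V a).1 x /\ (interp V b).1 x]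
  | SOr a b => of_intent [set y | (interp V a).2 y /\ (interp V b).2 y]
  | SLimp b a => of_extent [set x | forall y z,
      (interp V b).2 y /\ (interp V a).1 z -> Rdual y x z]
  | SFuse a b => of_intent [set y | forall x z,
      (interp V a).1 z /\ (interp V b).1 x -> Rdual y z x]
  | SRimp a b => of_extent [set x | forall z y,
      (interp V a).1 z /\ (interp V b).2 y -> Rdual y z x]
  end.

(* In a substructural model both Galois equivalences hold for every sentence.
   In an arbitrary frame this is a genuine condition on the valuation: nothing
   in the frame axioms makes the extent of an implication stable. *)
Record substr_model := SubstrModel {
  valuation : nat -> set (fX F);
  valuation_stable : forall i, stable (valuation i);
  sat_galois : forall phi x,
    (interp valuation phi).1 x <->
    (forall y, (interp valuation phi).2 y -> perp x y);
  cosat_galois : forall phi y,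
    (interp valuation phi).2 y <->
    (forall x, (interp valuation phi).1 x -> perp x y) }.

Definition extent (N : substr_model) (phi : sform) : set (fX F) :=
  (interp (valuation N) phi).1.
Definition intent (N : substr_model) (phi : sform) : set (fY F) :=
  (interp (valuation N) phi).2.

Definition substr_entails (N : substr_model) (phi psi : sform) : Prop :=
  extent N phi `<=` extent N psi.

End SubstructuralSemantics.

(* [MLimp a' a] is a' leftharpoonup a, and [MRimp a a'] is a rightharpoonup a'. *)
Inductive mform1 :=
  | MVar1 of nat
  | MTop1
  | MBot1
  | MNot1 of mform1
  | MAnd1 of mform1 & mform1
  | MBox1 of mform2
  | MFuse of mform1 & mform1
  | MLimp of mform1 & mform1
  | MRimp of mform1 & mform1
with mform2 :=
  | MVar2 of nat
  | MTop2
  | MBot2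
  | MNot2 of mform2
  | MAnd2 of mform2 & mform2
  | MBox2 of mform1.

Definition MOr1 a b := MNot1 (MAnd1 (MNot1 a) (MNot1 b)).
Definition MOr2 a b := MNot2 (MAnd2 (MNot2 a) (MNot2 b)).
Definition MDia1 b := MNot1 (MBox1 (MNot2 b)).
Definition MDia2 a := MNot2 (MBox2 (MNot1 a)).

Record modal_model (F : frame) := ModalModel {
  iP : nat -> set (fX F);
  iQ : nat -> set (fY F) }.

Section ModalSemantics.
Variables (F : frame) (M : modal_model F).

Fixpoint truth1 (a : mform1) : set (fX F) :=
  match a with
  | MVar1 i => iP M i
  | MTop1 => setT
  | MBot1 => set0
  | MNot1 a => ~` truth1 a
  | MAnd1 a b => truth1 a `&` truth1 b
  | MBox1 b => [set x | forall y, fI x y -> truth2 b y]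
  | MFuse a a' => [set x | exists z z', [/\ fR x z z', truth1 a z & truth1 a' z']]
  | MLimp a' a => [set x | forall z z', truth1 a z /\ fR z' x z -> truth1 a' z']
  | MRimp a a' => [set x | forall z z', truth1 a z /\ fR z' z x -> truth1 a' z']
  end
with truth2 (b : mform2) : set (fY F) :=
  match b with
  | MVar2 i => iQ M i
  | MTop2 => setT
  | MBot2 => set0
  | MNot2 b => ~` truth2 b
  | MAnd2 a b => truth2 a `&` truth2 b
  | MBox2 a => [set y | forall x, fI x y -> truth1 a x]
  end.

Definition entails1 (a a' : mform1) : Prop := truth1 a `<=` truth1 a'.
Definition entails2 (b b' : mform2) : Prop := truth2 b `<=` truth2 b'.

End ModalSemantics.

Fixpoint tr (phi : sform) : mform1 :=
  match phi with
  | SVar i => MBox1 (MDia2 (MVar1 i))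
  | STop => MTop1
  | SBot => MBot1
  | SAnd a b => MAnd1 (tr a) (tr b)
  | SOr a b => MBox1 (MOr2 (MDia2 (tr a)) (MDia2 (tr b)))
  | SLimp b a => MLimp (tr b) (tr a)
  | SFuse a b => MBox1 (MDia2 (MFuse (tr a) (tr b)))
  | SRimp a b => MRimp (tr a) (tr b)
  end.

Fixpoint cotr (phi : sform) : mform2 :=
  match phi with
  | SVar i => MBox2 (MNot1 (MVar1 i))
  | STop => MBot2
  | SBot => MTop2
  | SAnd a b => MBox2 (MOr1 (MDia1 (cotr a)) (MDia1 (cotr b)))
  | SOr a b => MAnd2 (cotr a) (cotr b)
  | SLimp b a => MBox2 (MNot1 (tr (SLimp b a)))
  | SFuse a b => MBox2 (MNot1 (MFuse (tr a) (tr b)))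
  | SRimp a b => MBox2 (MNot1 (tr (SRimp a b)))
  end.

(* Main.v *)
(** The forcing clauses fix one component of each sentence and the Galois maps fix the other.  Classically the Galois maps are the modal operators Box1 Not and Box2 Not (and their composites are Box1 Dia2 and Box2 Dia1), so an induction identifies extents and intents with the truth sets of translations and co-translations; the remaining equalities express that extents and intents determine each other. *)

Require Import Defs.
From mathcomp Require Import all_boot boolp classical_sets.

Local Open Scope classical_set_scope.

Section GaloisMaps.
Variable F : frame.
Implicit Types (A : set (fX F)) (B : set (fY F)).

Lemma rperpS A A' : A `<=` A' -> rperp A' `<=` rperp A.
Proof. by move=> sAA' y A'y x /sAA'; apply: A'y. Qed.

Lemma lperpS B B' : B `<=` B' -> lperp B' `<=` lperp B.
Proof. by move=> sBB' x B'x y /sBB'; apply: B'x. Qed.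

(** Needed for variables: the co-translation of [SVar i] uses the raw set [iP M i], whereas the
    valuation is its Galois closure. *)
Lemma rperpK A : rperp (lperp (rperp A)) = rperp A.
Proof.
apply/seteqP; split=> [|y Ay x]; last exact.
by apply: rperpS => x Ax y; apply.
Qed.

(** By seriality of [fI] no [y] is orthogonal to every point, so [MBot2] is the right co-translation
    of [STop]. *)
Lemma rperpT : rperp [set: fX F] = set0.
Proof.
apply/seteqP; split=> [y Ty|//].
by have [x nxy] := frame_serialY y; exact/nxy/Ty.
Qed.

Lemma lperpT : lperp [set: fY F] = set0.
Proof.
apply/seteqP; split=> [x Tx|//].
by have [y nxy] := frame_serialX x; exact/nxy/Tx.
Qed.

Lemma sbox1_sdia2 A : sbox1 (sdia2 A) = lperp (rperp A).
Proof.
apply/seteqP; split=> [x Ax y Ay|x Ax y nxy].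
  by apply: contrapT => /Ax[z [nzy /Ay]].
apply: contrapT => nAy; apply: nxy; apply: Ax => z Az.
by apply: contrapT => nzy; apply: nAy; exists z.
Qed.

End GaloisMaps.

Section ModalGaloisMaps.
Variables (F : frame) (M : modal_model F).

Lemma truth_box1_not b : truth1 M (MBox1 (MNot2 b)) = lperp (truth2 M b).
Proof.
apply/seteqP; split=> [x Hx y By|x Hx y nxy By]; last exact/nxy/Hx.
by apply: contrapT => /Hx.
Qed.

Lemma truth_box2_not a : truth2 M (MBox2 (MNot1 a)) = rperp (truth1 M a).
Proof.
apply/seteqP; split=> [y Hy x Ax|y Hy x nxy Ax]; last exact/nxy/Hy.
by apply: contrapT => /Hy.
Qed.

(** Each [MDia2] negates a [MBox2 (MNot1 _)], so by De Morgan the disjunction is the complement of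
    an intersection of two Galois images. *)
Lemma truth_box1_or2 a b : truth1 M (MBox1 (MOr2 (MDia2 a) (MDia2 b))) =
  lperp (rperp (truth1 M a) `&` rperp (truth1 M b)).
Proof.
rewrite truth_box1_not -!truth_box2_not; congr lperp.
by rewrite /= !setCK.
Qed.

Lemma truth_box2_or1 a b : truth2 M (MBox2 (MOr1 (MDia1 a) (MDia1 b))) =
  rperp (lperp (truth2 M a) `&` lperp (truth2 M b)).
Proof.
rewrite truth_box2_not -!truth_box1_not; congr rperp.
by rewrite /= !setCK.
Qed.

Lemma truth_box1_dia2 a :
  truth1 M (MBox1 (MDia2 a)) = lperp (rperp (truth1 M a)).
Proof. by rewrite truth_box1_not truth_box2_not. Qed.

Lemma truth_box2_dia1 b :
  truth2 M (MBox2 (MDia1 b)) = rperp (lperp (truth2 M b)).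
Proof. by rewrite truth_box2_not truth_box1_not. Qed.

End ModalGaloisMaps.

Section SubstructuralModel.
Variables (F : frame) (N : substr_model F).

Lemma extentE phi : extent N phi = lperp (intent N phi).
Proof. by apply/seteqP; split=> x /sat_galois. Qed.

Lemma intentE phi : intent N phi = rperp (extent N phi).
Proof. by apply/seteqP; split=> y /cosat_galois. Qed.

(** With the quantifier over [y] moved innermost, the clause says that [z'] lies in
    [lperp (intent N b)], which is [extent N b] by the Galois condition on models. *)
Lemma extent_limp b a : extent N (SLimp b a) =
  [set x | forall z z', extent N a z /\ fR z' x z -> extent N b z'].
Proof.
rewrite (extentE b); apply/seteqP; split=> x Hx.
  by move=> z z' [az Rz'] y by_; apply: Hx Rz'.
by move=> y z [by_ az] z' Rz'; apply: Hx by_; split; first exact: az.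
Qed.

Lemma extent_rimp a b : extent N (SRimp a b) =
  [set x | forall z z', extent N a z /\ fR z' z x -> extent N b z'].
Proof.
rewrite (extentE b); apply/seteqP; split=> x Hx.
  by move=> z z' [az Rz'] y by_; apply: Hx Rz'.
by move=> z y [az by_] z' Rz'; apply: Hx by_; split; first exact: az.
Qed.

(** Regrouping quantifiers turns the universal [Rdual] clause into orthogonality to an existential
    image, the one that interprets [MFuse]. *)
Lemma intent_fuse a b : intent N (SFuse a b) = rperp
  [set x | exists z z', [/\ fR x z z', extent N a z & extent N b z']].
Proof.
apply/seteqP; split=> y Hy.
  by move=> x [z [z' [Rx az bz']]]; apply: Hy Rx.
by move=> x z [az bx] w Rw; apply: Hy; exists z, x.
Qed.

End SubstructuralModel.

(** Each case of the joint induction computes the component that has a forcing clause and obtains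
    the other by [extentE] or [intentE]. *)
Lemma extent_intent_tr (F : frame) (M : modal_model F) (N : substr_model F)
    (hN : forall i, valuation N i = sbox1 (sdia2 (iP M i))) phi :
  extent N phi = truth1 M (tr phi) /\ intent N phi = truth2 M (cotr phi).
Proof.
elim: phi => [i|||a [Ea Ia] b [Eb Ib]|a [Ea Ia] b [Eb Ib]|b [Eb Ib] a [Ea Ia]
  |a [Ea Ia] b [Eb Ib]|a [Ea Ia] b [Eb Ib]].
- have EV : extent N (SVar i) = lperp (rperp (iP M i)).
    by rewrite -sbox1_sdia2 -hN.
  by rewrite intentE EV rperpK truth_box1_dia2 truth_box2_not.
- by rewrite intentE [extent N STop]/(setT) rperpT.
- by rewrite extentE [intent N SBot]/(setT) lperpT.
- have EA : extent N (SAnd a b) = extent N a `&` extent N b by [].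
  rewrite intentE EA; split; first by rewrite Ea Eb.
  (* The conjuncts appear as [lperp] of intents; folding these back into extents recovers [rperp] of
     the intersection. *)
  by rewrite [cotr _]/= truth_box2_or1 -Ia -Ib -!extentE.
- have IO : intent N (SOr a b) = intent N a `&` intent N b by [].
  rewrite extentE IO; split; last by rewrite Ia Ib.
  by rewrite [tr _]/= truth_box1_or2 -Ea -Eb -!intentE.
- have EL : extent N (SLimp b a) = truth1 M (tr (SLimp b a)).
    by rewrite extent_limp Ea Eb.
  by rewrite intentE EL [cotr _]/= truth_box2_not.
- have IF : intent N (SFuse a b) = rperp (truth1 M (MFuse (tr a) (tr b))).
    by rewrite intent_fuse Ea Eb.
  by rewrite extentE IF [tr _]/= [cotr _]/= truth_box1_dia2 truth_box2_not.
- have ER : extent N (SRimp a b) = truth1 M (tr (SRimp a b)).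
    by rewrite extent_rimp Ea Eb.
  by rewrite intentE ER [cotr _]/= truth_box2_not.
Qed.

Theorem theorem4p1 (c : frame_class) (F : frame) (hF : in_class c F)
    (M : modal_model F) (N : substr_model F)
    (hN : forall i : nat, valuation N i = sbox1 (sdia2 (iP M i)))
    (phi psi : sform) :
  [/\ [/\ extent N phi = truth1 M (tr phi),
          truth1 M (tr phi) = truth1 M (MBox1 (MNot2 (cotr phi)))
        & truth1 M (MBox1 (MNot2 (cotr phi)))
            = truth1 M (MBox1 (MDia2 (tr phi)))],
      [/\ intent N phi = truth2 M (cotr phi),
          truth2 M (cotr phi) = truth2 M (MBox2 (MNot1 (tr phi)))
        & truth2 M (MBox2 (MNot1 (tr phi)))
            = truth2 M (MBox2 (MDia1 (cotr phi)))]
    & (substr_entails N phi psi <-> entails1 M (tr phi) (tr psi)) /\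
      (entails1 M (tr phi) (tr psi) <-> entails2 M (cotr psi) (cotr phi))].
Proof.
have tr_extent chi := (extent_intent_tr F M N hN chi).1.
have tr_intent chi := (extent_intent_tr F M N hN chi).2.
(* Expressed through extents and intents, all but the last equivalence becomes trivial; that one
   holds because both Galois maps reverse inclusion. *)
rewrite truth_box1_dia2 truth_box2_dia1 truth_box1_not truth_box2_not.
rewrite /entails1 /entails2 -!tr_extent -!tr_intent -!extentE -!intentE -extentE.
split=> //; split=> //; split; first by rewrite !intentE; apply: rperpS.
by rewrite (extentE _ _ phi) (extentE _ _ psi); apply: lperpS.
Qed.
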